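(* $\Lambda$ is the initial $\lambda$-theory; that is, $\Lambda$ is an initial object of the category of $\lambda$-theories.
   Context: **Algebraic theories.** $\mathbf F$ is the category with objects the finite sets $n=\{1,\dots,n\}$ and all functions. An algebraic theory $\mathcal T$ is a functor $\mathcal T:\mathbf F\to\mathbf{Sets}$ with projections $\mathbf{pr}_1,\dots,\mathbf{pr}_n\in\mathcal T(n)$ (in particular $\mathbf{id}=\mathbf{pr}_1\in\mathcal T(1)$) and compositions $\mathcal T(n)\times\mathcal T(m)^n\to\mathcal T(m)$, $(f,g_1,\dots,g_n)\mapsto f(g_1,\dots,g_n)$, satisfying associativity, $f(\mathbf{pr}_1,\dots,\mathbf{pr}_n)=f$, $\mathbf{pr}_i(g_1,\dots,g_n)=g_i$, and $\mathcal T(\varphi)(f)=f(\mathbf{pr}_{\varphi(1)},\dots,\mathbf{pr}_{\varphi(n)})$ for $\varphi:n\to m$. A map of algebraic theories is a natural transformation preserving projections and composition. **$\lambda$-theories.** A $\lambda$-theory is an algebraic theory $\mathcal L$ equipped with semi-closed structure: maps $\rho:\mathcal L(n)\to\mathcal L(n+1)$ and $\lambda:\mathcal L(n+1)\to\mathcal L(n)$ with $\rho\circ\lambda=\mathrm{id}$, natural in $n$ and compatible with the actions $\mathcal L(m)\times\mathcal L(n)^m\to\mathcal L(n)$ (composition) and $\mathcal L(m+1)\times\mathcal L(n)^m\to\mathcal L(n+1)$, the latter being $(s,g_1,\dots,g_m)\mapsto s(g_1,\dots,g_m,\mathbf{pr}_{n+1})$ with the $g_i$ weakened to $\mathcal L(n+1)$.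 A map of $\lambda$-theories is a map of algebraic theories commuting with $\rho$ and $\lambda$. **$\Lambda$.** $\Lambda(n)$ is the set of terms of the (untyped) $\lambda$-calculus in context of $n$ variables, factored out by $\beta$-equality. Projections are the variables, composition is substitution, the retraction $\rho:\Lambda(n)\to\Lambda(n+1)$ is $t\mapsto tz$ (with $z$ the new variable), and the section $\lambda:\Lambda(n+1)\to\Lambda(n)$ is $s\mapsto\lambda z.s$. *)

(* Defs.v *)
From HB Require Import structures.
From mathcomp Require Import all_boot.
From mathcomp Require Import boolp.

Set Implicit Arguments.
Unset Strict Implicit.
Unset Printing Implicit Defensive.

Local Open Scope quotient_scope.

Record category := Category {
  obj :> Type;
  hom : obj -> obj -> Type;
  idc : forall a, hom a a;
  compc : forall a b c, hom b c -> hom a b -> hom a c;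
  compc1 : forall a b (f : hom a b), compc f (idc a) = f;
  comp1c : forall a b (f : hom a b), compc (idc b) f = f;
  compcA : forall a b c d (f : hom c d) (g : hom b c) (h : hom a b),
    compc f (compc g h) = compc (compc f g) h
}.

Definition is_initial (C : category) (a : C) : Prop :=
  forall b : C, exists f : hom a b, forall g : hom a b, g = f.

(* The context [n] is ['I_n], and the variable added by passing from [n] to
   [n.+1] is the last one, [ord_max]; [lift ord_max : 'I_n -> 'I_n.+1] is thus
   the inclusion of the old variables. *)
Definition extend (T : Type) n (g : 'I_n -> T) (x : T) (i : 'I_n.+1) : T :=
  if unlift ord_max i is Some j then g j else x.

(* The function [phi + 1], fixing the new variable. *)
Definition lift_fun n m (phi : 'I_n -> 'I_m) : 'I_n.+1 -> 'I_m.+1 :=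
  extend (fun i => lift ord_max (phi i)) ord_max.

(* [act] is the action on morphisms of the functor from finite sets to sets;
   n-tuples of elements of [op m] are functions ['I_n -> op m]. *)
Record alg_theory := AlgTheory {
  op :> nat -> Type;
  act : forall n m, ('I_n -> 'I_m) -> op n -> op m;
  pr : forall n, 'I_n -> op n;
  tcomp : forall n m, op n -> ('I_n -> op m) -> op m;
  act_id : forall n (f : op n), act id f = f;
  act_comp : forall n m p (psi : 'I_m -> 'I_p) (phi : 'I_n -> 'I_m) (f : op n),
    act (psi \o phi) f = act psi (act phi f);
  tcompA : forall n m p (f : op n) (g : 'I_n -> op m) (h : 'I_m -> op p),
    tcomp (tcomp f g) h = tcomp f (fun i => tcomp (g i) h);
  tcomp_pr : forall n (f : op n), tcomp f (@pr n) = f;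
  pr_tcomp : forall n m (i : 'I_n) (g : 'I_n -> op m), tcomp (pr i) g = g i;
  actE : forall n m (phi : 'I_n -> 'I_m) (f : op n),
    act phi f = tcomp f (fun i => pr (phi i))
}.

Arguments pr {a n} i.

Record is_alg_map (S T : alg_theory) (F : forall n, S n -> T n) : Prop :=
  IsAlgMap {
    map_act : forall n m (phi : 'I_n -> 'I_m) (f : S n),
      F m (act phi f) = act phi (F n f);
    map_pr : forall n (i : 'I_n), F n (pr i) = pr i;
    map_tcomp : forall n m (f : S n) (g : 'I_n -> S m),
      F m (tcomp f g) = tcomp (F n f) (fun i => F m (g i))
  }.

(* The action of [T n] on [T m.+1]:
   [s] and [g] are sent to [s(g_1, ..., g_m, pr_{n+1})]. *)
Definition tcomp_lift (T : alg_theory) m n (s : T m.+1) (g : 'I_m -> T n) :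
    T n.+1 :=
  tcomp s (extend (fun i => act (lift ord_max) (g i)) (pr ord_max)).

Record lambda_theory := LambdaTheory {
  theory :> alg_theory;
  rho : forall n, theory n -> theory n.+1;
  lam : forall n, theory n.+1 -> theory n;
  rho_lam : forall n (s : theory n.+1), rho (lam s) = s;
  rho_act : forall n m (phi : 'I_n -> 'I_m) (f : theory n),
    rho (act phi f) = act (lift_fun phi) (rho f);
  lam_act : forall n m (phi : 'I_n -> 'I_m) (s : theory n.+1),
    lam (act (lift_fun phi) s) = act phi (lam s);
  rho_tcomp : forall m n (f : theory m) (g : 'I_m -> theory n),
    rho (tcomp f g) = tcomp_lift (rho f) g;
  lam_tcomp : forall m n (s : theory m.+1) (g : 'I_m -> theory n),
    lam (tcomp_lift s g) = tcomp (lam s) g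
}.

Record lambda_map (K L : lambda_theory) := LambdaMap {
  lmap :> forall n, K n -> L n;
  lmap_alg : is_alg_map lmap;
  lmap_rho : forall n (f : K n), lmap (rho f) = rho (lmap f);
  lmap_lam : forall n (s : K n.+1), lmap (lam s) = lam (lmap s)
}.

Arguments lmap {K L} _ {n} _.

Lemma lambda_map_eq K L (F G : lambda_map K L) :
  (forall n (f : K n), F n f = G n f) -> F = G.
Proof.
case: F G => [F a r l] [G a' r' l'] /= e.
have E : F = G by apply: functional_extensionality_dep => n; apply: funext.
by case: _ / E in a' r' l' *; congr LambdaMap; apply: Prop_irrelevance.
Qed.

Definition lambda_map_id (L : lambda_theory) : lambda_map L L.
Proof. by exists (fun n f => f). Defined.

Definition lambda_map_comp (K L M : lambda_theory) (G : lambda_map L M)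
  (F : lambda_map K L) : lambda_map K M.
Proof.
exists (fun n f => G n (F n f)).
- case: (lmap_alg F) (lmap_alg G) => a p c [a' p' c'].
  by split=> *; rewrite ?(a, p, c) ?(a', p', c').
- by move=> n f; rewrite !lmap_rho.
- by move=> n f; rewrite !lmap_lam.
Defined.

Definition lambda_theories : category.
Proof.
by exists lambda_theory lambda_map lambda_map_id lambda_map_comp => *;
  apply: lambda_map_eq.
Defined.

(* Well-scoped terms, which represent terms up to alpha-equivalence:
   in [Lam t] the bound variable is [ord_max : 'I_n.+1]. *)
Inductive term (n : nat) : Type :=
| Var (i : 'I_n)
| App (t u : term n)
| Lam (t : term n.+1).

Arguments Var {n} i.

Fixpoint rename n m (phi : 'I_n -> 'I_m) (t : term n) : term m :=
  match t with
  | Var i => Var (phi i)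
  | App t u => App (rename phi t) (rename phi u)
  | Lam t => Lam (rename (lift_fun phi) t)
  end.

Definition weaken n (t : term n) : term n.+1 := rename (lift ord_max) t.

Definition lift_subst n m (s : 'I_n -> term m) : 'I_n.+1 -> term m.+1 :=
  extend (fun i => weaken (s i)) (Var ord_max).

Fixpoint subst n m (s : 'I_n -> term m) (t : term n) : term m :=
  match t with
  | Var i => s i
  | App t u => App (subst s t) (subst s u)
  | Lam t => Lam (subst (lift_subst s) t)
  end.

Inductive beta_eq (n : nat) : term n -> term n -> Prop :=
| beta_red (t : term n.+1) (u : term n) :
    beta_eq (App (Lam t) u) (subst (extend Var u) t)
| beta_app t t' u u' :
    beta_eq t t' -> beta_eq u u' -> beta_eq (App t u) (App t' u')
| beta_lam (t t' : term n.+1) : beta_eq t t' -> beta_eq (Lam t) (Lam t')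
| beta_refl t : beta_eq t t
| beta_sym t u : beta_eq t u -> beta_eq u t
| beta_trans t u v : beta_eq t u -> beta_eq u v -> beta_eq t v.

Lemma extend_lift T n (g : 'I_n -> T) x i : extend g x (lift ord_max i) = g i.
Proof. by rewrite /extend liftK. Qed.

Lemma extend_max T n (g : 'I_n -> T) x : extend g x ord_max = x.
Proof. by rewrite /extend unlift_none. Qed.

Definition extendE := (extend_lift, extend_max).

Lemma eq_extend T n (f g : 'I_n.+1 -> T) :
  (forall i, f (lift ord_max i) = g (lift ord_max i)) ->
  f ord_max = g ord_max -> f = g.
Proof. by move=> e e'; apply: funext => i; case: (unliftP ord_max i) => [j|] ->. Qed.

Lemma lift_fun_id n : lift_fun (@id 'I_n) = id.
Proof. by apply: eq_extend => [i|]; rewrite /lift_fun !extendE. Qed.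

Lemma lift_fun_comp n m p (psi : 'I_m -> 'I_p) (phi : 'I_n -> 'I_m) :
  lift_fun (psi \o phi) = lift_fun psi \o lift_fun phi.
Proof. by apply: eq_extend => [i|]; rewrite /= /lift_fun !extendE. Qed.

Lemma rename_id n (t : term n) : rename id t = t.
Proof. by elim: t => //= {}n => [t -> u ->|t]; rewrite ?lift_fun_id // => ->. Qed.

Lemma rename_comp n m p (psi : 'I_m -> 'I_p) (phi : 'I_n -> 'I_m) t :
  rename psi (rename phi t) = rename (psi \o phi) t.
Proof.
elim: t m p psi phi => //= {}n => [t IHt u IHu|t IHt] m p psi phi.
  by rewrite IHt IHu.
by rewrite IHt lift_fun_comp.
Qed.

Lemma rename_subst n m (phi : 'I_n -> 'I_m) t :
  rename phi t = subst (fun i => Var (phi i)) t.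
Proof.
elim: t m phi => //= {}n => [t IHt u IHu|t IHt] m phi; first by rewrite IHt IHu.
rewrite IHt; congr (Lam (subst _ _)).
by apply: eq_extend => [i|]; rewrite /lift_subst /lift_fun !extendE.
Qed.

Lemma subst_rename n m p (s : 'I_m -> term p) (phi : 'I_n -> 'I_m) t :
  subst s (rename phi t) = subst (s \o phi) t.
Proof.
elim: t m p s phi => //= {}n => [t IHt u IHu|t IHt] m p s phi.
  by rewrite IHt IHu.
rewrite IHt; congr (Lam (subst _ _)).
by apply: eq_extend => [i|]; rewrite /lift_subst /= /lift_fun !extendE.
Qed.

Lemma rename_subst_comp n m p (phi : 'I_m -> 'I_p) (s : 'I_n -> term m) t :
  rename phi (subst s t) = subst (fun i => rename phi (s i)) t.
Proof.
elim: t m p phi s => //= {}n => [t IHt u IHu|t IHt] m p phi s.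
  by rewrite IHt IHu.
rewrite IHt; congr (Lam (subst _ _)).
apply: eq_extend => [i|]; rewrite /lift_subst /= ?extendE /=.
  rewrite /weaken !rename_comp; congr (rename _ _).
  by apply: funext => j; rewrite /= /lift_fun extendE.
by rewrite /lift_fun extendE.
Qed.

Lemma subst_comp n m p (s : 'I_n -> term m) (r : 'I_m -> term p) t :
  subst r (subst s t) = subst (fun i => subst r (s i)) t.
Proof.
elim: t m p s r => //= {}n => [t IHt u IHu|t IHt] m p s r.
  by rewrite IHt IHu.
rewrite IHt; congr (Lam (subst _ _)).
apply: eq_extend => [i|]; rewrite /lift_subst ?extendE /= ?extendE //.
rewrite /weaken subst_rename rename_subst_comp; congr (subst _ _).
by apply: funext => j; rewrite /= extendE.
Qed.

Lemma subst_var n (t : term n) : subst Var t = t.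
Proof. by rewrite -[RHS]rename_id rename_subst. Qed.

Lemma beta_subst n m (s : 'I_n -> term m) t u :
  beta_eq t u -> beta_eq (subst s t) (subst s u).
Proof.
move=> tu; elim: tu m s => {n t u} [n t u|n t t' u u' _ IHt _ IHu|n t t' _ IHt|
  n t|n t u _ IH|n t u v _ IH1 _ IH2] m s /=; try by constructor; auto.
- rewrite subst_comp.
  rewrite (_ : subst _ t =
    subst (extend Var (subst s u)) (subst (lift_subst s) t)).
    exact: beta_red.
  rewrite subst_comp; congr (subst _ _).
  apply: eq_extend => [i|]; rewrite /lift_subst !extendE /= ?extendE //.
  rewrite /weaken subst_rename -[LHS]subst_var; congr (subst _ _).
  by apply: funext => j; rewrite /= extendE.
- exact: beta_trans (IH1 _ _) (IH2 _ _).
Qed.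

Lemma beta_rename n m (phi : 'I_n -> 'I_m) t u :
  beta_eq t u -> beta_eq (rename phi t) (rename phi u).
Proof. by rewrite !rename_subst; apply: beta_subst. Qed.

Lemma beta_subst_arg n m (s r : 'I_n -> term m) t :
  (forall i, beta_eq (s i) (r i)) -> beta_eq (subst s t) (subst r t).
Proof.
elim: t m s r => {n} [n i|n t IHt u IHu|n t IHt] m s r sr //=.
- by apply: beta_app; [apply: IHt|apply: IHu].
- apply/beta_lam/IHt => i; rewrite /lift_subst.
  case: (unliftP ord_max i) => [j|] ->; rewrite !extendE.
    exact: beta_rename.
  exact: beta_refl.
Qed.

HB.instance Definition _ n := gen_eqMixin (term n).
HB.instance Definition _ n := gen_choiceMixin (term n).

Definition beta_eqb n (t u : term n) : bool := `[< beta_eq t u >].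

Lemma beta_eqb_equiv n : equiv_class_of (@beta_eqb n).
Proof.
split=> [t|t u|u t v /asboolP tu /asboolP uv]; first exact/asboolP/beta_refl.
  by apply/asboolP/asboolP; apply: beta_sym.
exact/asboolP/(beta_trans tu uv).
Qed.

Canonical beta_equiv n := EquivRelPack (beta_eqb_equiv n).

Definition Lambda_op n : Type := {eq_quot @beta_eqb n}.

Definition cls n (t : term n) : Lambda_op n := \pi_({eq_quot @beta_eqb n}) t.

Definition rep n (f : Lambda_op n) : term n := repr (f : {eq_quot @beta_eqb n}).

Lemma repK n (f : Lambda_op n) : cls (rep f) = f.
Proof. exact: reprK. Qed.

Lemma clsP n (t u : term n) : cls t = cls u <-> beta_eq t u.
Proof.
by split=> [/eqmodP/asboolP //|tu]; apply/eqmodP/asboolP.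
Qed.

Lemma rep_cls n (t : term n) : beta_eq (rep (cls t)) t.
Proof. by apply/clsP; rewrite repK. Qed.

Definition Lambda_act n m (phi : 'I_n -> 'I_m) (f : Lambda_op n) : Lambda_op m :=
  cls (rename phi (rep f)).

Definition Lambda_pr n (i : 'I_n) : Lambda_op n := cls (Var i).

Definition Lambda_tcomp n m (f : Lambda_op n) (g : 'I_n -> Lambda_op m) :
    Lambda_op m :=
  cls (subst (fun i => rep (g i)) (rep f)).

Definition Lambda_rho n (f : Lambda_op n) : Lambda_op n.+1 :=
  cls (App (weaken (rep f)) (Var ord_max)).

Definition Lambda_lam n (s : Lambda_op n.+1) : Lambda_op n := cls (Lam (rep s)).

Lemma Lambda_actE n m (phi : 'I_n -> 'I_m) t :
  Lambda_act phi (cls t) = cls (rename phi t).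
Proof. exact/clsP/beta_rename/rep_cls. Qed.

Lemma Lambda_tcompE n m t (s : 'I_n -> term m) :
  Lambda_tcomp (cls t) (fun i => cls (s i)) = cls (subst s t).
Proof.
apply/clsP/(beta_trans (beta_subst _ (rep_cls t))).
by apply: beta_subst_arg => i; apply: rep_cls.
Qed.

Lemma Lambda_rhoE n (t : term n) :
  Lambda_rho (cls t) = cls (App (weaken t) (Var ord_max)).
Proof. exact/clsP/beta_app/beta_refl/beta_rename/rep_cls. Qed.

Lemma Lambda_lamE n (t : term n.+1) : Lambda_lam (cls t) = cls (Lam t).
Proof. exact/clsP/beta_lam/rep_cls. Qed.

Lemma cls_tuple n m (g : 'I_n -> Lambda_op m) : g = fun i => cls (rep (g i)).
Proof. by apply: funext => i; rewrite repK. Qed.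

Definition Lambda_alg : alg_theory.
Proof.
exists Lambda_op Lambda_act Lambda_pr Lambda_tcomp.
- by move=> n f; rewrite /Lambda_act rename_id repK.
- move=> n m p psi phi f; rewrite -(repK f) !Lambda_actE.
  by rewrite rename_comp.
- move=> n m p f g h; rewrite -(repK f) (cls_tuple g) (cls_tuple h).
  under [in RHS]eq_fun do rewrite Lambda_tcompE.
  by rewrite !Lambda_tcompE subst_comp.
- by move=> n f; rewrite -(repK f) Lambda_tcompE subst_var.
- by move=> n m i g; rewrite (cls_tuple g) Lambda_tcompE.
- by move=> n m phi f; rewrite -(repK f) Lambda_actE Lambda_tcompE rename_subst.
Defined.

Lemma Lambda_tcomp_liftE n m (t : term n.+1) (s : 'I_n -> term m) :
  @tcomp_lift Lambda_alg n m (cls t) (fun i => cls (s i)) =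
  cls (subst (lift_subst s) t).
Proof.
rewrite -Lambda_tcompE /tcomp_lift /=; congr (Lambda_tcomp _ _).
by apply: eq_extend => [i|]; rewrite /lift_subst !extendE //= Lambda_actE.
Qed.

Definition Lambda : lambda_theory.
Proof.
exists Lambda_alg Lambda_rho Lambda_lam.
- move=> n s; rewrite -(repK s) Lambda_lamE Lambda_rhoE; apply/clsP.
  set t := rep s; rewrite /weaken /=.
  apply: beta_trans (beta_red _ _) _; rewrite subst_rename.
  rewrite (_ : _ \o _ = Var) ?subst_var; first exact: beta_refl.
  by apply: eq_extend => [i|]; rewrite /= /lift_fun !extendE.
- move=> n m phi f; rewrite -(repK f) /= Lambda_actE !Lambda_rhoE Lambda_actE.
  rewrite /= /lift_fun extendE /weaken !rename_comp; congr (cls (App (rename _ _) _)).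
  by apply: funext => i; rewrite /= extendE.
- by move=> n m phi s; rewrite -(repK s) /= Lambda_actE !Lambda_lamE Lambda_actE.
- move=> n m f g; rewrite -(repK f) (cls_tuple g).
  rewrite -[tcomp _ _]/(Lambda_tcomp _ _) Lambda_tcompE !Lambda_rhoE.
  rewrite Lambda_tcomp_liftE /= /lift_subst extendE /weaken.
  rewrite rename_subst_comp subst_rename; congr (cls (App (subst _ _) _)).
  by apply: funext => i; rewrite /= extendE.
- move=> n m s g; rewrite -(repK s) (cls_tuple g) Lambda_tcomp_liftE.
  by rewrite !Lambda_lamE /= Lambda_tcompE.
Defined.

(* Main.v *)
Require Import Defs.
From mathcomp Require Import all_boot.
From mathcomp Require Import boolp.

(** In any lambda-theory [L] an application can be recovered from the
    retraction: [f b] is [rho f], with [b] substituted for the new variable.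
    A lambda-term can therefore be interpreted in [L] by recursion, reading
    variables as projections, application as this [app], and abstraction as
    [lam].  The interpretation turns renaming into the functor action and
    substitution into composition, because [app] and [lam] are compatible with
    composition ([interp_rename], [interp_subst]).  Beta-equal terms have the
    same interpretation ([interp_beta]): for a redex this is [rho_lam] followed
    by the substitution lemma.  So the interpretation descends to [Lambda],
    where the equations just listed say that it is a map of lambda-theories.

    For uniqueness, application in [Lambda] is the instance of [app] at
    [Lambda] itself ([Lambda_app]), and maps of lambda-theories preserve [app]
    ([lmap_app]) since they preserve [rho], projections and composition.  Hence
    such a map is determined on every term by recursion, and must be the
    interpretation. *)

Set Implicit Arguments.
Unset Strict Implicit.
Unset Printing Implicit Defensive.

Lemma comp_extend (S T : Type) (h : S -> T) n (g : 'I_n -> S) x :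
  (fun i => h (extend g x i)) = extend (fun i => h (g i)) (h x).
Proof. by apply: eq_extend => [i|]; rewrite !extendE. Qed.

Lemma act_pr (T : alg_theory) n m (phi : 'I_n -> 'I_m) (i : 'I_n) :
  act phi (pr i) = pr (phi i) :> T m.
Proof. by rewrite actE pr_tcomp. Qed.

Lemma tcomp_act (T : alg_theory) n m p (f : T n) (phi : 'I_n -> 'I_m)
    (h : 'I_m -> T p) :
  tcomp (act phi f) h = tcomp f (fun i => h (phi i)).
Proof.
by rewrite actE tcompA; congr tcomp; apply: funext => i; rewrite pr_tcomp.
Qed.

Definition app (L : lambda_theory) n (f b : L n) : L n :=
  tcomp (rho f) (extend pr b).

(** Both sides are [rho f] with [g] substituted for the old variables and
    [tcomp b g] for the new one. *)
Lemma app_tcomp (L : lambda_theory) n m (f b : L n) (g : 'I_n -> L m) :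
  app (tcomp f g) (tcomp b g) = tcomp (app f b) g.
Proof.
rewrite /app rho_tcomp /tcomp_lift !tcompA; congr tcomp.
apply: eq_extend => [i|]; rewrite !extendE ?pr_tcomp ?extendE //.
(* Substituting for the new variable does not affect a weakened [g i]. *)
rewrite tcomp_act -[RHS]tcomp_pr; congr tcomp.
by apply: funext => j; rewrite extendE.
Qed.

Lemma app_act (L : lambda_theory) n m (phi : 'I_n -> 'I_m) (f b : L n) :
  app (act phi f) (act phi b) = act phi (app f b).
Proof. by rewrite !actE app_tcomp. Qed.

Lemma lmap_app (K L : lambda_theory) (F : lambda_map K L) n (f b : K n) :
  F n (app f b) = app (F n f) (F n b).
Proof.
have [_ Fpr Fcomp] := lmap_alg F.
rewrite /app Fcomp lmap_rho comp_extend; congr (tcomp _ (extend _ _)).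
by apply: funext => i; apply: Fpr.
Qed.

Lemma Lambda_app n (t u : term n) :
  app (L := Lambda) (cls t) (cls u) = cls (App t u).
Proof.
rewrite /app /= Lambda_rhoE -(comp_extend (@cls n) Var u) Lambda_tcompE.
rewrite /= extendE /weaken subst_rename; congr (cls (App _ _)).
by rewrite -[RHS]subst_var; congr subst; apply: funext => i; rewrite /= extendE.
Qed.

Fixpoint interp (L : lambda_theory) n (t : term n) : L n :=
  match t with
  | Var i => pr i
  | App t u => app (interp L t) (interp L u)
  | Lam t => lam (interp L t)
  end.

(** Renaming is treated before substitution because substituting under a binder
    weakens the substituted terms. *)
Lemma interp_rename (L : lambda_theory) n m (phi : 'I_n -> 'I_m) t :
  interp L (rename phi t) = act phi (interp L t).
Proof.
elim: t m phi => {n} [n i|n t IHt u IHu|n t IHt] m phi /=.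
- by rewrite act_pr.
- by rewrite IHt IHu app_act.
- by rewrite IHt lam_act.
Qed.

Lemma interp_subst (L : lambda_theory) n m (s : 'I_n -> term m) t :
  interp L (subst s t) = tcomp (interp L t) (fun i => interp L (s i)).
Proof.
elim: t m s => {n} [n i|n t IHt u IHu|n t IHt] m s /=.
- by rewrite pr_tcomp.
- by rewrite IHt IHu app_tcomp.
- rewrite IHt -lam_tcomp /tcomp_lift; congr (lam (tcomp _ _)).
  rewrite /lift_subst comp_extend; congr extend.
  by apply: funext => i; apply: interp_rename.
Qed.

Lemma interp_beta (L : lambda_theory) n (t u : term n) :
  beta_eq t u -> interp L t = interp L u.
Proof.
elim=> {n t u} //= [n t u|n t t' u u' _ -> _ -> //|n t t' _ -> //|
  n t u v _ -> _ //].
by rewrite /app rho_lam interp_subst comp_extend.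
Qed.

Definition denote (L : lambda_theory) n (f : Lambda n) : L n := interp L (rep f).

Lemma denote_cls (L : lambda_theory) n (t : term n) :
  denote L (cls t : Lambda n) = interp L t.
Proof. exact/interp_beta/rep_cls. Qed.

(** The retraction of [Lambda] sends a term to its application to a new
    variable, so compatibility with [rho] amounts to recovering [rho f] as [app]
    of the weakened [f] and the new variable. *)
Definition denote_map (L : lambda_theory) : lambda_map Lambda L.
Proof.
exists (denote L).
- split=> [n m phi f|n i|n m f g].
  + by rewrite [LHS]denote_cls interp_rename.
  + by rewrite [LHS]denote_cls.
  + by rewrite [LHS]denote_cls interp_subst.
- move=> n f; rewrite [LHS]denote_cls /= interp_rename /app rho_act.
  (* The old variables are weakened and the new one is substituted for itself,
     which is the identity substitution. *)
  rewrite tcomp_act -[RHS]tcomp_pr; congr tcomp.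
  by apply: eq_extend => [i|]; rewrite /lift_fun !extendE.
- by move=> n s; rewrite [LHS]denote_cls.
Defined.

Lemma lmap_cls (L : lambda_theory) (F : lambda_map Lambda L) n (t : term n) :
  F n (cls t) = interp L t.
Proof.
elim: t => {n} [n i|n t IHt u IHu|n t IHt] /=.
- exact: (map_pr (lmap_alg F)).
- by rewrite -Lambda_app lmap_app IHt IHu.
- by rewrite -Lambda_lamE [LHS]lmap_lam IHt.
Qed.

Theorem theorem3p8 : @is_initial lambda_theories Lambda.
Proof.
move=> L; exists (denote_map L) => F; apply: lambda_map_eq => n f.
by rewrite -(repK f) lmap_cls /= denote_cls.
Qed.
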